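(* Let $\alpha$ be a formula over a finite signature $\Sigma$ and let $v\in\mathcal I_c$ be a classical interpretation. Then $v$ is an equilibrium model of $\alpha$ if and only if $[\![\alpha]\!]\cap\{v\}\downarrow=\{v\}$.
   Context: $\Sigma$ is a finite set of atoms. Formulas are given by $\alpha ::= \bot \mid p \mid \alpha_1\wedge\alpha_2 \mid \alpha_1\vee\alpha_2 \mid \alpha_1\rightarrow\alpha_2$ with $p\in\Sigma$. A partial interpretation is a map $v:\Sigma\to\{0,1,2\}$; $\mathcal I$ is the set of all of them and $\mathcal I_c$ the set of classical ones (no atom mapped to $1$). The $G_3$ valuation extends $v$ to formulas: $v(\bot)=0$, $v(\alpha\wedge\beta)=\min(v(\alpha),v(\beta))$, $v(\alpha\vee\beta)=\max(v(\alpha),v(\beta))$, $v(\alpha\to\beta)=2$ if $v(\alpha)\le v(\beta)$ and $=v(\beta)$ otherwise; $v$ is a model of $\alpha$ iff $v(\alpha)=2$. The order on $\mathcal I$: $u\le v$ iff for every atom $p$, $u(p)\le v(p)$ and ($u(p)=0$ implies $v(p)=0$); $u<v$ means $u\le v$, $u\ne v$. A classical interpretation $v\in\mathcal I_c$ is an equilibrium model of $\alpha$ iff it is a $\le$-minimal model of $\alpha$. For $S\subseteq\mathcal I$: $\overline S=\mathcal I\setminus S$; $S_c=S\cap\mathcal I_c$; $S\downarrow=\{u\in\mathcal I:\exists v\in S,\ v\ge u\}$. The denotation: $[\![\bot]\!]=\emptyset$; $[\![p]\!]=\{v\in\mathcal I: v(p)=2\}$; $[\![\alpha\wedge\beta]\!]=[\![\alpha]\!]\cap[\![\beta]\!]$;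 $[\![\alpha\vee\beta]\!]=[\![\alpha]\!]\cup[\![\beta]\!]$; $[\![\alpha\to\beta]\!]=\big(\overline{[\![\alpha]\!]}\cup[\![\beta]\!]\big)\cap\big(\overline{[\![\alpha]\!]}\cup[\![\beta]\!]\big)_c\downarrow$. *)

(* Defs.v *)
From mathcomp Require Import all_boot all_order.

Set Implicit Arguments.
Unset Strict Implicit.
Unset Printing Implicit Defensive.

Section HereAndThere.

Variable Sigma : finType.

Inductive formula : Type :=
| Bot
| Atom of Sigma
| And of formula & formula
| Or of formula & formula
| Imp of formula & formula.

(* The truth values 0, 1, 2 are the elements of 'I_3; ord0 is 0, ord_max is 2,
   and Order.min, Order.max refer to the usual order of 'I_3. *)
Definition interp : finType := {ffun Sigma -> 'I_3}.

Implicit Types (u v : interp) (S : {set interp}) (a : formula).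

Definition classical : {set interp} :=
  [set v : interp | [forall p, (v p : nat) != 1]].

Fixpoint val3 v a : 'I_3 :=
  match a with
  | Bot => ord0
  | Atom p => v p
  | And a1 a2 => Order.min (val3 v a1) (val3 v a2)
  | Or a1 a2 => Order.max (val3 v a1) (val3 v a2)
  | Imp a1 a2 => if val3 v a1 <= val3 v a2 then ord_max else val3 v a2
  end.

Definition model v a : bool := val3 v a == ord_max.

Definition ile u v : bool :=
  [forall p, (u p <= v p) && ((u p == ord0) ==> (v p == ord0))].

Definition ilt u v : bool := ile u v && (u != v).

Definition equilibrium_model v a : Prop :=
  [/\ v \in classical, model v a & forall u, ilt u v -> ~ model u a].

Definition cpart S : {set interp} := S :&: classical.

Definition down S : {set interp} := [set u | [exists v in S, ile u v]].

Fixpoint denot a : {set interp} :=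
  match a with
  | Bot => set0
  | Atom p => [set v : interp | v p == ord_max]
  | And a1 a2 => denot a1 :&: denot a2
  | Or a1 a2 => denot a1 :|: denot a2
  | Imp a1 a2 =>
      (~: denot a1 :|: denot a2) :&: down (cpart (~: denot a1 :|: denot a2))
  end.

End HereAndThere.

(* Main.v *)
Require Import Defs.
From mathcomp Require Import all_boot all_order.

(**
  The denotation of a formula is its set of G3 models.  Only implication is
  not immediate: the unique classical interpretation above [v] is [there v],
  which sends every nonzero value to 2, and evaluation commutes with this
  collapse.  So membership in the denotation of [a -> b] says that
  [v(a) = 2] forces [v(b) = 2] and that [v(a) <> 0] forces [v(b) <> 0], which
  on three values is [v(a) <= v(b)].
*)

Set Implicit Arguments.
Unset Strict Implicit.
Unset Printing Implicit Defensive.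

(** This is double negation in the three-element Gödel chain. *)
Definition collapse (x : 'I_3) : 'I_3 := if x == ord0 then ord0 else ord_max.

(** Puts closed constants in place of a truth value, so that the remaining goals are settled by
    computation. *)
Lemma ord3_ind (P : 'I_3 -> Prop) :
  P ord0 -> P (Ordinal (isT : 1 < 3)) -> P ord_max -> forall x, P x.
Proof.
move=> P0 P1 P2 [[|[|[|//]]] mlt].
- by rewrite (_ : Ordinal mlt = ord0) //; apply: val_inj.
- by rewrite (_ : Ordinal mlt = Ordinal (isT : 1 < 3)) //; apply: val_inj.
- by rewrite (_ : Ordinal mlt = ord_max) //; apply: val_inj.
Qed.

Section Denotation.

Variable Sigma : finType.

Implicit Types (u v : interp Sigma) (a b : formula Sigma).

Definition there v : interp Sigma := [ffun p => collapse (v p)].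

Lemma ile_refl v : ile v v.
Proof. by apply/forallP => p; rewrite leqnn implybb. Qed.

Lemma there_classical v : there v \in classical Sigma.
Proof.
by rewrite inE; apply/forallP => p; rewrite ffunE; elim/ord3_ind: (v p).
Qed.

Lemma ile_there v : ile v (there v).
Proof. by apply/forallP => p; rewrite ffunE; elim/ord3_ind: (v p). Qed.

(** Going up along [ile] keeps zeros zero and nonzero values nonzero, so a classical [v] must be 2
    wherever [u] is nonzero. *)
Lemma classical_ile_there u v : v \in classical Sigma -> ile u v -> v = there u.
Proof.
rewrite inE => /forallP cv /forallP uv; apply/ffunP => p; rewrite ffunE.
by move: (cv p) (uv p); elim/ord3_ind: (u p); elim/ord3_ind: (v p).
Qed.

Lemma val3_there v a : val3 (there v) a = collapse (val3 v a).
Proof.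
elim: a => [|p|a IHa b IHb|a IHa b IHb|a IHa b IHb] //=; first by rewrite ffunE.
all: by rewrite IHa IHb; elim/ord3_ind: (val3 v a); elim/ord3_ind: (val3 v b).
Qed.

Lemma in_down_cpart (S : {set interp Sigma}) v :
  (v \in down (cpart S)) = (there v \in S).
Proof.
rewrite inE; apply/existsP/idP => [[w]|tS]; last first.
  by exists (there v); rewrite inE tS there_classical ile_there.
by rewrite inE => /andP[/andP[wS cw] /(classical_ile_there cw) <-].
Qed.

Lemma in_denot a v : (v \in denot a) = model v a.
Proof.
(* [v] stays general: the implication case uses the induction hypotheses at [there v] as well. *)
rewrite /model; elim: a v => [|p|a IHa b IHb|a IHa b IHb|a IHa b IHb] v /=;
  try by rewrite !inE ?IHa ?IHb; elim/ord3_ind: (val3 v a); elim/ord3_ind: (val3 v b).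
- by rewrite inE.
- by rewrite inE.
rewrite inE in_down_cpart !inE !IHa !IHb !val3_there.
by elim/ord3_ind: (val3 v a); elim/ord3_ind: (val3 v b).
Qed.

Lemma in_down1 u v : (u \in down [set v]) = ile u v.
Proof.
rewrite inE; apply/existsP/idP => [[w /andP[/set1P->]] //|uv].
by exists v; rewrite set11.
Qed.

End Denotation.

Theorem theorem6 (Sigma : finType) (a : formula Sigma) (v : interp Sigma)
    (hv : v \in classical Sigma) :
  equilibrium_model v a <-> denot a :&: down [set v] = [set v].
Proof.
split=> [[_ va vmin]|/setP eqv].
  apply/setP => u; rewrite in_setI in_denot in_down1 in_set1.
  apply/andP/eqP => [[ua uv]|->]; last by rewrite va ile_refl.
  by apply/eqP/negPn/negP => uNv; apply: (vmin u) => //; rewrite /ilt uv.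
split=> // [|u /andP[uv uNv] ua].
  by have:= eqv v; rewrite in_setI in_denot set11 => /andP[].
(* A model strictly below [v] would lie in the intersection, hence equal [v]. *)
have:= eqv u; rewrite in_setI in_denot in_down1 in_set1 ua uv.
by rewrite (negbTE uNv).
Qed.
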